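(* Let $t>0$ and, for $n\ge 2$, let $$h_n(x;t)=\sum_{d=1}^{n-1}\sum_{i=1}^{d}\binom{n-i-1}{d-i}\binom{n-d-1}{i-1}\,t^i x^d .$$ Define numbers $\gamma_{n,i}$ ($n\ge 2$, $0\le i\le\lfloor n/2\rfloor$) by $\gamma_{2,0}=\gamma_{3,0}=0$, $\gamma_{2,1}=\gamma_{3,1}=t$, the conventions $\gamma_{n,-1}=\gamma_{n,\lfloor n/2\rfloor+1}=0$ for $n\ge 2$, and the recurrence $$\gamma_{n,i}=\gamma_{n-1,i}+t\,\gamma_{n-2,i-1}\qquad (n\ge 4,\ 0\le i\le\lfloor n/2\rfloor).$$ Then for every $n\ge 2$, $$h_n(x;t)=\sum_{i=0}^{\lfloor n/2\rfloor}\gamma_{n,i}\,x^i(1+x)^{n-2i}.$$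
   Context: Binomial coefficients $\binom{m}{k}$ are $0$ when $k>m$ or $k<0$. $h_n(x;t)=\sum_{d=1}^{n-1}g_{U_{n,d}}(t)x^d$ is the generating function of Speyer's $g$-polynomials of the uniform matroids $U_{n,d}$. *)

(* Defs.v *)
From HB Require Import structures.
From mathcomp Require Import all_boot all_order all_algebra.
From mathcomp Require Import zify.

Set Implicit Arguments.
Unset Strict Implicit.
Unset Printing Implicit Defensive.

Import Order.TTheory GRing.Theory Num.Theory.
Local Open Scope ring_scope.

(* The truncated subtractions are exact: 1 <= i <= d <= n - 1 in the sums. *)
Definition h (R : realFieldType) (t : R) (n : nat) : {poly R} :=
  \sum_(1 <= d < n) \sum_(1 <= i < d.+1)
    ('C(n - i - 1, d - i)%:R * 'C(n - d - 1, i - 1)%:R * t ^+ i) *: 'X^d.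

(* The second index is an integer because the recurrence at i = 0 refers to
   gamma_{n-2,-1}.  Values at n < 2, or with i outside [-1, n./2 + 1], are
   unconstrained. *)
Record gamma_family (R : realFieldType) (t : R) (gamma : nat -> int -> R) : Prop :=
  GammaFamily {
    gamma_2_0 : gamma 2%N 0 = 0;
    gamma_3_0 : gamma 3%N 0 = 0;
    gamma_2_1 : gamma 2%N 1 = t;
    gamma_3_1 : gamma 3%N 1 = t;
    gamma_left : forall n : nat, (2 <= n)%N -> gamma n (-1) = 0;
    gamma_right : forall n : nat, (2 <= n)%N -> gamma n (n./2.+1)%:Z = 0;
    gamma_rec : forall (n : nat) (i : int),
      (4 <= n)%N -> 0 <= i <= (n./2)%:Z ->
      gamma n i = gamma (n - 1)%N i + t * gamma (n - 2)%N (i - 1)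
  }.

Lemma gamma_family_exists (R : realFieldType) (t : R) :
  exists gamma : nat -> int -> R, gamma_family t gamma.
Proof.
pose fix g (n : nat) (i : int) {struct n} : R :=
  if 0 <= i <= (n./2)%:Z then
    match n with
    | m.+1 => match m with
      | k.+1 => if (n < 4)%N then (if i == 0 then 0 else t)
                else g m i + t * g k (i - 1)
      | 0%N => 0 end
    | 0%N => 0 end
  else 0.
exists g; split=> //.
- by case.
- case=> [|[|n]] // _.
  have out : (0 <= (n.+2./2.+1)%:Z <= (n.+2./2)%:Z) = false by lia.
  by rewrite /g -/g out.
- case=> [|[|[|[|n]]]] // i _ ir.
  by rewrite subn1 subn2 [LHS]/g -/g ir.
Qed.

Lemma gamma_family_unique (R : realFieldType) (t : R) (g1 g2 : nat -> int -> R) :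
  gamma_family t g1 -> gamma_family t g2 ->
  forall (n : nat) (i : int), (2 <= n)%N -> 0 <= i <= (n./2)%:Z ->
  g1 n i = g2 n i.
Proof.
move=> G1 G2 n i n2 ir.
have {}ir : (i == -1) || (i == (n./2.+1)%:Z) || (0 <= i <= (n./2)%:Z) by lia.
elim/ltn_ind: n n2 i ir => n IH n2 i.
case/orP=> [/orP[]/eqP->|ir].
- by rewrite (gamma_left G1) ?(gamma_left G2).
- by rewrite (gamma_right G1) ?(gamma_right G2).
case: (ltnP n 4) => n4.
  have [en|en] : n = 2%N \/ n = 3%N by lia.
  - rewrite en /= in ir *; have [->|->] : i = 0 \/ i = 1 by lia.
      by rewrite (gamma_2_0 G1) (gamma_2_0 G2).
    by rewrite (gamma_2_1 G1) (gamma_2_1 G2).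
  - rewrite en /= in ir *; have [->|->] : i = 0 \/ i = 1 by lia.
      by rewrite (gamma_3_0 G1) (gamma_3_0 G2).
    by rewrite (gamma_3_1 G1) (gamma_3_1 G2).
rewrite (gamma_rec G1) // (gamma_rec G2) // !IH //; lia.
Qed.

(* Main.v *)
Require Import Defs.
From HB Require Import structures.
From mathcomp Require Import all_boot all_order all_algebra.
From mathcomp Require Import zify ring.

Import Order.TTheory GRing.Theory Num.Theory.
Local Open Scope ring_scope.

(** The recurrence is solved by gamma_{n,i} = C(n-i-1, i-1) t^i (Pascal's rule).
    Comparing coefficients of t^i x^d, the theorem reduces to the identity
    C(n-i-1, d-i) C(n-d-1, i-1) = C(n-i-1, i-1) C(n-2i, d-i), both sides being
    the trinomial coefficient (n-i-1)! / ((d-i)! (i-1)! (n-d-i)!). *)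

(** Both sides count ordered pairs of disjoint subsets of sizes [a] and [b] in an [N]-element
    set. *)
Lemma mul_binCA (N a b : nat) :
  ('C(N, a) * 'C(N - a, b) = 'C(N, b) * 'C(N - b, a))%N.
Proof.
case: (leqP (a + b) N) => [le_abN|lt_Nab]; last first.
  (* Factorials apply only for [a + b <= N]; beyond that both products vanish. *)
  have zero (c d : nat) : (N < c + d -> 'C(N, c) * 'C(N - c, d) = 0)%N.
    move=> lt_Ncd; case: (ltnP N c) => [/bin_small -> //|le_cN].
    by rewrite (bin_small (n := N - c)) ?muln0 //; lia.
  by rewrite !zero // addnC.
have fact_pos : (0 < a`! * b`! * (N - a - b)`!)%N by rewrite !muln_gt0 !fact_gt0.
apply/eqP; rewrite -(eqn_pmul2r fact_pos); apply/eqP.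
have Ea : ('C(N, a) * (a`! * (N - a)`!) = N`!)%N by apply: bin_fact; lia.
have Eb : ('C(N, b) * (b`! * (N - b)`!) = N`!)%N by apply: bin_fact; lia.
have Eab : ('C(N - a, b) * (b`! * (N - a - b)`!) = (N - a)`!)%N.
  by apply: bin_fact; lia.
have Eba : ('C(N - b, a) * (a`! * (N - a - b)`!) = (N - b)`!)%N.
  by rewrite subnAC; apply: bin_fact; lia.
transitivity N`!; first by rewrite -Ea -Eab; ring.
by rewrite -Eb -Eba; ring.
Qed.

Lemma coef_expr1DX (R : comNzRingType) (m k : nat) :
  ((1 + 'X : {poly R}) ^+ m)`_k = 'C(m, k)%:R.
Proof.
elim: m k => [|m IHm] k; first by rewrite expr0 coef1 bin0n.
rewrite exprS mulrDl mul1r coefD coefXM IHm.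
by case: k => [|k] /=; rewrite ?addr0 ?bin0 // IHm binS natrD.
Qed.

(** At [i = 0] the recurrence only copies the previous row, since the column [-1] vanishes. *)
Lemma gamma_family_at0 (R : realFieldType) (t : R) (gamma : nat -> int -> R) :
  gamma_family t gamma -> forall n : nat, (2 <= n)%N -> gamma n 0 = 0.
Proof.
move=> G; elim/ltn_ind=> n IHn n2.
case: (ltnP n 4) => n4.
  have [->|->] : n = 2%N \/ n = 3%N by lia.
    exact: gamma_2_0 G.
  exact: gamma_3_0 G.
rewrite (gamma_rec G) // IHn ?sub0r ?(gamma_left G) ?mulr0 ?addr0 //; lia.
Qed.

(* The range includes the boundary value i + 1 = n./2 + 1, where the binomial
   coefficient vanishes, as the recurrence for gamma_{n,n/2} with n even refers to it. *)
Lemma gamma_familyE (R : realFieldType) (t : R) (gamma : nat -> int -> R) :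
  gamma_family t gamma -> forall n i : nat, (2 <= n)%N -> (i <= n./2)%N ->
  gamma n i.+1%:Z = 'C(n - i.+2, i)%:R * t ^+ i.+1.
Proof.
move=> G; elim/ltn_ind=> n IHn i n2 le_i.
have [->|ne_i] := eqVneq i n./2.
  rewrite (gamma_right G) // bin_small ?mul0r //; lia.
case: (ltnP n 4) => n4.
  have -> : i = 0%N by lia.
  rewrite bin0 mul1r expr1.
  have [->|->] : n = 2%N \/ n = 3%N by lia.
    exact: gamma_2_1 G.
  exact: gamma_3_1 G.
rewrite (gamma_rec G) //; last lia.
have -> : i.+1%:Z - 1 = i by lia.
rewrite IHn; [|lia..].
case: i le_i ne_i => [|i] le_i ne_i.
  by rewrite (gamma_family_at0 _ _ _ G) ?bin0 ?mulr0 ?addr0 //; lia.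
rewrite IHn; [|lia..].
(* The case [i < n./2] makes [n - i.+3] a true successor, so Pascal's rule applies. *)
have -> : (n - i.+3 = (n - 1 - i.+3).+1)%N by lia.
have -> : (n - 2 - i.+2 = n - 1 - i.+3)%N by lia.
by rewrite binS natrD !exprS; ring.
Qed.

Lemma coef_h (R : realFieldType) (t : R) (n d : nat) : (0 < d < n)%N ->
  (h t n)`_d = \sum_(1 <= i < d.+1)
    'C(n - i - 1, d - i)%:R * 'C(n - d - 1, i - 1)%:R * t ^+ i.
Proof.
move=> d_range; rewrite /h coef_sum (bigD1_seq d) ?iota_uniq ?mem_index_iota //=.
rewrite [X in _ + X]big1_seq ?addr0 => [|e /andP[ne_ed _]].
  by rewrite coef_sum; apply: eq_bigr => i _; rewrite coefZ coefXn eqxx mulr1.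
rewrite coef_sum big1 // => i _.
by rewrite coefZ coefXn eq_sym (negPf ne_ed) mulr0.
Qed.

Lemma coef_h_out (R : realFieldType) (t : R) (n d : nat) : ~~ (0 < d < n)%N ->
  (h t n)`_d = 0.
Proof.
move=> d_out; rewrite /h coef_sum big1_seq // => e /=.
rewrite mem_index_iota => e_range; rewrite coef_sum big1 // => i _.
have /negPf ne_de : d != e by apply: contraNneq d_out => ->.
by rewrite coefZ coefXn ne_de mulr0.
Qed.

Theorem theorem6p1 (R : realFieldType) (t : R) (gamma : nat -> int -> R)
    (t_gt0 : 0 < t) (gammaP : gamma_family t gamma) (n : nat) (n_ge2 : (2 <= n)%N) :
  h t n =
    \sum_(0 <= i < n./2.+1) gamma n i%:Z *: ('X^i * (1 + 'X) ^+ (n - 2 * i)).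
Proof.
(* The term [i = 0] drops out, and the shifted index fits the closed form of [gamma]. *)
rewrite big_nat_recl //= (gamma_family_at0 _ _ _ gammaP) // scale0r add0r.
apply/polyP => d; rewrite [RHS]coef_sum.
under [RHS]eq_big_nat => i i_lt.
  rewrite coefZ coefXnM coef_expr1DX (gamma_familyE _ _ _ gammaP) //; last lia.
  over.
have [d_range|d_out] := boolP (0 < d < n)%N; last first.
  rewrite coef_h_out // big1_seq // => i /=; rewrite mem_index_iota => i_lt.
  case: ifP => lt_di; rewrite ?mulr0 // (bin_small (m := d - i.+1)) ?mulr0 //; lia.
rewrite coef_h // big_add1 /=.
(* The bounds [i < d] and [i < n./2] become conditions under the common bound [n], so that the sums
   compare termwise. *)
rewrite (big_nat_widen _ _ n) /=; last lia.
rewrite [RHS](big_nat_widen _ _ n) /=; last lia.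
rewrite big_mkcond [RHS]big_mkcond; apply: eq_big_nat => i i_lt.
case: (ltnP i d) => [lt_id|le_di]; last first.
  by case: ifP => // _; rewrite ltnS le_di mulr0.
have -> : (d < i.+1)%N = false by lia.
have -> : (n - i.+1 - 1 = n - i.+2)%N by lia.
have -> : (n - d - 1 = n - i.+2 - (d - i.+1))%N by lia.
(* Here [N = n - i.+2], [a = d - i.+1] and [b = i]. *)
rewrite subn1 /= -natrM mul_binCA.
(* For [i >= n./2] the left term vanishes too, because [n - i.+2 < i]. *)
case: ifP => [lt_i|ge_i]; last by rewrite bin_small ?mul0r //; lia.
have -> : (n - i.+2 - i = n - 2 * i.+1)%N by lia.
by rewrite natrM; ring.
Qed.
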